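(* Let $\mathcal{H}$ be a complex Hilbert space with $\dim\mathcal{H}\geqslant 2$. For any vectors $a,b,x,y\in\mathcal{H}$ and any $q\in[0,1]$ such that $\|x\|=\|y\|=1$ and $\langle x,y\rangle=q$, we have $$|\langle a,x\rangle\,\langle b,y\rangle|\leqslant \frac{\|a\|\,\|b\|+q\,|\langle a,b\rangle|}{2}+\frac{\sqrt{1-q^2}}{2}\,\sqrt{\|a\|^2\|b\|^2-|\langle a,b\rangle|^2}.$$
   Context: The inner product $\langle\cdot,\cdot\rangle$ is linear in the first argument and conjugate-linear in the second. *)

(* Defs.v *)
From HB Require Import structures.
From mathcomp Require Import all_boot all_order all_algebra.
From mathcomp Require Import complex.
From mathcomp Require Import all_classical all_reals all_analysis.

Set Implicit Arguments.
Unset Strict Implicit.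
Unset Printing Implicit Defensive.

Import Order.TTheory GRing.Theory Num.Theory.
Import numFieldNormedType.Exports.

Local Open Scope ring_scope.
Local Open Scope complex_scope.

(* Complex Hilbert spaces over R[i], for R a realType. A form of type
   {dot H for Num.conj} is linear in its first argument, conjugate-linear in
   its second one, hermitian and positive definite. The norm takes values in
   R[i]; there, u <= v means that v - u is a nonnegative real. *)
HB.mixin Record NormedModule_hasInner (R : realType) H
    of CompleteNormedModule R[i] H := {
  inner : {dot H for (@Num.conj R[i])} ;
  innerE : forall x : H, inner x x = `|x| ^+ 2
}.

#[short(type="hilbertType")]
HB.structure Definition Hilbert (R : realType) :=
  {H of CompleteNormedModule R[i] H & NormedModule_hasInner R H}.

(* dim V >= n: n vectors of V are linearly independent. V need not be finite
   dimensional. *)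
Definition dim_ge (K : fieldType) (V : lmodType K) (n : nat) : Prop :=
  exists e : 'I_n -> V, forall c : 'I_n -> K,
    \sum_(i < n) c i *: e i = 0 -> forall i, c i = 0.

(* Main.v *)
(* For unit vectors u, v put d(u, v) = arccos |<u, v>|, an angle in [0, pi/2].
   Positivity of the Gram matrix of three unit vectors gives the triangle
   inequality for d (the Fubini-Study metric), whence
     |d(a, b) - d(x, y)| <= d(a, x) + d(b, y) <= pi.
   For unit a, b, with r = d(a, x) and s = d(b, y), one gets
     2 cos r cos s = cos (r + s) + cos (r - s)
                  <= cos (d(a, b) - d(x, y)) + 1,
   which expands to the claim because cos d(x, y) = q. The general case follows
   by homogeneity in a and b. *)
Require Import Defs.
From mathcomp Require Import all_boot all_order all_algebra.
From mathcomp Require Import complex.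
From mathcomp Require Import all_classical all_reals all_analysis.
From mathcomp Require Import ring lra.
Import Order.TTheory GRing.Theory Num.Theory.
Import numFieldNormedType.Exports.
Local Open Scope ring_scope.
Local Open Scope complex_scope.

Lemma ler_cos {R : realType} : {in `[0, pi] &, {mono @cos R : s t /~ t <= s}}.
Proof. by move=> s t sI tI; rewrite !leNgt ltr_cos. Qed.

Lemma acos_le_pihalf {R : realType} (r : R) : 0 <= r <= 1 -> acos r <= pi / 2.
Proof.
move=> /andP[r0 r1]; have r11 : -1 <= r <= 1 by lra.
have pi0 := @pi_ge0 R.
rewrite -ler_cos ?in_itv /= ?acos_ge0 ?acos_lepi//; last by lra.
by rewrite cos_pihalf acosK ?in_itv.
Qed.

Lemma norm_normc {R : rcfType} (z : R[i]) : `|z| = (Normc.normc z)%:C.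
Proof. by case: z. Qed.

Lemma normc_ge0 {R : rcfType} (z : R[i]) : 0 <= Normc.normc z.
Proof. by rewrite -ler0c -norm_normc. Qed.

Section Dot.
Set Implicit Arguments.
Unset Strict Implicit.
Context {C : numClosedFieldType} {U : lmodType C} (f : {dot U for Num.conj}).
Implicit Types u v w : U.

Lemma dotC u v : f v u = (f u v)^*%R.
Proof. by rewrite (hermC f v u) expr0 mul1r. Qed.

Lemma dotBl u v w : f (u - v) w = f u w - f v w.
Proof. exact: linearBl. Qed.

Lemma dotBr u v w : f u (v - w) = f u v - f u w.
Proof. exact: linearBr. Qed.

Lemma dotZl c u v : f (c *: u) v = c * f u v.
Proof. exact: linearZl_LR. Qed.

Lemma dotZr c u v : f u (c *: v) = c^*%R * f u v.
Proof. exact: linearZr_LR. Qed.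

Lemma cauchy_schwarz_dot u v : `|f u v| ^+ 2 <= f u u * f v v.
Proof.
have [->|v0] := eqVneq v 0.
  by rewrite !linear0r normr0 expr0n.
have vv0 : 0 < f v v by rewrite dnorm_gt0.
(* This vector is [f v v] times the component of [u] orthogonal to [v]; the scaling avoids a
   division. *)
have := dnorm_ge0 f (f v v *: u - f u v *: v).
have -> : f (f v v *: u - f u v *: v) (f v v *: u - f u v *: v)
  = f v v * (f u u * f v v - `|f u v| ^+ 2).
  rewrite !(dotBl, dotBr, dotZl, dotZr) normCK -!dotC /=.
  ring.
by rewrite pmulr_rge0// subr_ge0.
Qed.

(* Cauchy-Schwarz for the components of [u] and [w] orthogonal to [v]. *)
Lemma gram_dot u v w : f u u = 1 -> f v v = 1 -> f w w = 1 ->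
  `|f u w - f u v * f v w| ^+ 2
    <= (1 - `|f u v| ^+ 2) * (1 - `|f v w| ^+ 2).
Proof.
move=> u1 v1 w1.
have := cauchy_schwarz_dot (u - f u v *: v) (w - f w v *: v).
rewrite !(dotBl, dotBr, dotZl, dotZr) -!dotC u1 v1 w1.
rewrite !mulr1 !subrr !subr0.
by rewrite !normCK -!dotC [f v u * _]mulrC [f v w * f u v]mulrC.
Qed.
End Dot.

Section Hilbert.
Set Implicit Arguments.
Unset Strict Implicit.
Context {R : realType} {H : hilbertType R}.
Implicit Types u v w : H.
Local Notation ip := (@inner R H).
Local Notation normc := Normc.normc.

Lemma inner_unit u : `|u| = 1 -> ip u u = 1.
Proof. by move=> u1; rewrite innerE u1 expr1n. Qed.

Lemma normc_innerC u v : normc (ip v u) = normc (ip u v).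
Proof. by apply: complexI; rewrite -!norm_normc (dotC ip u v) norm_conjC. Qed.

Lemma normc_inner_le1 u v : `|u| = 1 -> `|v| = 1 -> 0 <= normc (ip u v) <= 1.
Proof.
move=> /inner_unit u1 /inner_unit v1; rewrite normc_ge0 /=.
rewrite -(ler_pXn2r (n := 2)) ?nnegrE ?normc_ge0// expr1n -lecR rmorphXn /=.
by have := cauchy_schwarz_dot ip u v; rewrite u1 v1 mulr1 norm_normc.
Qed.

Definition angle u v : R := acos (normc (ip u v)).

Lemma angleC u v : angle u v = angle v u.
Proof. by rewrite /angle normc_innerC. Qed.

Section Unit.
Context {u v : H} (u1 : `|u| = 1) (v1 : `|v| = 1).

Let le1 : -1 <= normc (ip u v) <= 1.
Proof. by have := normc_inner_le1 u1 v1; lra. Qed.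

Lemma cos_angle : cos (angle u v) = normc (ip u v).
Proof. by rewrite acosK ?in_itv. Qed.

Lemma sin_angle : sin (angle u v) = Num.sqrt (1 - normc (ip u v) ^+ 2).
Proof. by rewrite sin_acos. Qed.

Lemma angle_ge0 : 0 <= angle u v. Proof. exact: acos_ge0. Qed.

Lemma angle_le_pihalf : angle u v <= pi / 2.
Proof. exact/acos_le_pihalf/normc_inner_le1. Qed.
End Unit.

(** As [cos] decreases on [0, pi] and each angle is at most pi / 2, it suffices to compare cosines.
    Expanding the cosine of the sum leaves a bound by a product of two sines, which [gram_dot]
    provides. *)
Lemma angle_triangle u v w : `|u| = 1 -> `|v| = 1 -> `|w| = 1 ->
  angle u w <= angle u v + angle v w.
Proof.
move=> u1 v1 w1.
have := angle_ge0 u1 v1; have := angle_ge0 v1 w1; have := angle_ge0 u1 w1.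
have := angle_le_pihalf u1 v1; have := angle_le_pihalf v1 w1.
have := angle_le_pihalf u1 w1; have := @pi_ge0 R => *.
rewrite -ler_cos ?in_itv /=; [|lra|lra].
rewrite cosD !cos_angle// !sin_angle// lerBlDr -lerBlDl.
have /andP[uv0 uv1] := normc_inner_le1 u1 v1.
have /andP[vw0 vw1] := normc_inner_le1 v1 w1.
(* Reverse triangle inequality for the modulus, in [R[i]]. *)
have : (normc (ip u v) * normc (ip v w) - normc (ip u w))%:C
    <= (normc (ip u v * ip v w - ip u w))%:C.
  by rewrite rmorphB rmorphM /= -!norm_normc -normrM lerB_dist.
rewrite lecR => /le_trans; apply.
(* With both sides written as square roots, only the squared inequality [gram_dot] remains. *)
rewrite -sqrtrM ?subr_ge0 ?expr_le1//.
rewrite -(ger0_norm (normc_ge0 _)) -sqrtr_sqr ler_wsqrtr//.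
have := gram_dot (inner_unit u1) (inner_unit v1) (inner_unit w1).
rewrite distrC !norm_normc -!rmorphXn /= -(rmorph1 (real_complex R)).
by rewrite -!rmorphB -rmorphM lecR.
Qed.

Lemma unit_inner_mul_le a b x y :
    `|a| = 1 -> `|b| = 1 -> `|x| = 1 -> `|y| = 1 ->
  normc (ip a x) * normc (ip b y) <=
    (1 + normc (ip x y) * normc (ip a b)) / 2
    + Num.sqrt (1 - normc (ip x y) ^+ 2) / 2
      * Num.sqrt (1 - normc (ip a b) ^+ 2).
Proof.
move=> a1 b1 x1 y1.
rewrite -!sin_angle// -!cos_angle//.
(* One sign follows from the path a, x, y, b, the other from the path x, a, b, y; each uses two
   triangle inequalities. *)
have abxy : `|angle a b - angle x y| <= angle a x + angle b y.
  have := angle_triangle a1 x1 b1; have := angle_triangle x1 y1 b1.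
  have := angle_triangle x1 a1 y1; have := angle_triangle a1 b1 y1.
  rewrite (angleC y b) (angleC x a) ler_norml.
  by move=> *; lra.
have := angle_le_pihalf a1 x1; have := angle_le_pihalf b1 y1 => by2 ax2.
have := angle_ge0 a1 x1; have := angle_ge0 b1 y1 => by0 ax0.
have : cos (angle a x + angle b y) <= cos (angle a b - angle x y).
  (* The difference may be negative; evenness of [cos] replaces it by its absolute value, which lies
     in [0, pi]. *)
  rewrite -[leRHS]cos_norm ler_cos// in_itv /= ?normr_ge0/=; lra.
have := cos_le1 (angle a x - angle b y).
rewrite !cosB cosD; lra.
Qed.

(** The given unit vector serves as the direction when [u] is zero, so that normalization needs no
    separate case later. *)
Lemma unit_direction u : (exists v : H, `|v| = 1) ->
  exists2 v : H, `|v| = 1 & u = `|u| *: v.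
Proof.
move=> [v v1]; have [->|u0] := eqVneq u 0.
  by exists v; rewrite ?normr0 ?scale0r.
have nu0 : `|u| != 0 by rewrite normr_eq0.
exists (`|u|^-1 *: u); last by rewrite scalerA divff// scale1r.
by rewrite normrZ normfV normr_id mulVf.
Qed.
End Hilbert.

Lemma sqrtC_realc {R : rcfType} (r : R) : 0 <= r -> sqrtC r%:C = (Num.sqrt r)%:C.
Proof.
by move=> r0; rewrite -{1}(sqr_sqrtr r0) rmorphXn /= sqrCK// ler0c sqrtr_ge0.
Qed.

Theorem corollary2p2 (R : realType) (H : hilbertType R) (dimH : dim_ge H 2)
    (a b x y : H) (q : R) (q01 : 0 <= q <= 1)
    (normx : `|x| = 1) (normy : `|y| = 1) (xy : inner x y = q%:C) :
  `|inner a x * inner b y| <=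
    (`|a| * `|b| + q%:C * `|inner a b|) / 2
    + sqrtC (1 - q%:C ^+ 2) / 2
      * sqrtC (`|a| ^+ 2 * `|b| ^+ 2 - `|inner a b| ^+ 2).
Proof.
(* Reduction to unit vectors: both sides scale by [|a| * |b|]. *)
have [u u1 aE] := unit_direction a (ex_intro _ x normx).
have [v v1 bE] := unit_direction b (ex_intro _ x normx).
have ab0 : 0 <= `|a| * `|b| by rewrite mulr_ge0.
have -> : `|inner a x * inner b y| = `|a| * `|b| * `|inner u x * inner v y|.
  by rewrite {1}aE {1}bE !dotZl !normrM !normr_id mulrACA.
have -> : `|inner a b| = `|a| * `|b| * `|inner u v|.
  by rewrite {1}aE {1}bE dotZl dotZr !normrM norm_conjC !normr_id mulrA.
have -> : `|a| ^+ 2 * `|b| ^+ 2 - (`|a| * `|b| * `|inner u v|) ^+ 2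
    = (`|a| * `|b|) ^+ 2 * (1 - `|inner u v| ^+ 2) by ring.
have uv1 : 0 <= 1 - Normc.normc (inner u v) ^+ 2.
  by have /andP[? ?] := normc_inner_le1 u1 v1; rewrite subr_ge0 expr_le1.
have q1 : 0 <= 1 - q ^+ 2 by case/andP: q01 => ? ?; rewrite subr_ge0 expr_le1.
(* The unit case, carried from [R] to [R[i]] along the embedding of the reals. *)
have key : `|inner u x * inner v y| <=
    (1 + q%:C * `|inner u v|) / 2
    + sqrtC (1 - q%:C ^+ 2) / 2 * sqrtC (1 - `|inner u v| ^+ 2).
  have := unit_inner_mul_le u1 v1 normx normy.
  have -> : Normc.normc (inner x y) = q.
    by apply: complexI; rewrite -norm_normc xy ger0_norm// ler0c; case/andP: q01.
  rewrite -lecR !(rmorphD, rmorphM, rmorphB, rmorph1, fmorphV, rmorphXn) /=.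
  rewrite -!sqrtC_realc// !(rmorphB, rmorphXn, rmorph1) /= -!norm_normc.
  by rewrite normrM.
(* Both factors under the root are nonnegative, so [|a| * |b|] can be pulled out of it. *)
rewrite sqrtCM ?nnegrE ?sqr_ge0//; last first.
  by rewrite norm_normc -rmorphXn -(rmorph1 (real_complex R)) -rmorphB ler0c.
rewrite sqrCK//.
have := ler_wpM2l ab0 key.
congr (_ <= _); ring.
Qed.
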